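(* Let $n \geq 1$ be an integer, and for each integer $k \geq 0$ let $B_k(x) = (x+1)(x+2)\cdots(x+k)$, with $B_0(x) = 1$. In the generating set $$\left\{ \frac{n}{\gcd(k!, n)} \cdot B_k(x) \;\middle|\; k \in \mathbb{Z}_{\geq 0} \right\}$$ of the ideal of vanishing polynomials over $\mathbb{Z}_n$, each $B_k(x)$ can be replaced with the product $(x+c_{k,1})(x+c_{k,2})\cdots(x+c_{k,k})$ of any sequence of terms $x+c_{k,1}, \ldots, x+c_{k,k}$ (with integers $c_{k,j}$) such that the product is divisible by $\gcd(n, k!)$ for every integer $x$, and the resulting set is still a generating set for the ideal of vanishing polynomials over $\mathbb{Z}_n$. For instance, one may take $B_k(x) = (x+i)(x+i+1)\cdots(x+i+k-1)$ for any integer $i$.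
   Context: $\mathbb{Z}_n$ denotes the ring of integers modulo $n$. A polynomial $F(x) \in \mathbb{Z}_n[x]$ is a vanishing polynomial over $\mathbb{Z}_n$ if $F(a) = 0$ for all $a \in \mathbb{Z}_n$. The vanishing polynomials form an ideal of $\mathbb{Z}_n[x]$. Polynomials with integer coefficients are regarded as elements of $\mathbb{Z}_n[x]$ by reducing coefficients modulo $n$. An empty product (the case $k=0$) equals $1$. *)

(* Defs.v *)
From HB Require Import structures.
From mathcomp Require Import all_boot all_order all_algebra.

Set Implicit Arguments.
Unset Strict Implicit.
Unset Printing Implicit Defensive.

Import GRing.Theory.

Local Open Scope ring_scope.

(* The zero ring Z/1Z. MathComp's ['Z_1] is Z/2Z, and ['I_1] carries no
   canonical ring structure there. *)
Definition Z1 : Type := 'I_1.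

HB.instance Definition _ := GRing.Zmodule.on Z1.
HB.instance Definition _ :=
  GRing.Zmodule_isComPzRing.Build Z1
    (@Zp_mulA 1) (@Zp_mulC 1) (@Zp_mul1z 0) (@Zp_mul_addl 1).

Definition Zn (n : nat) : comPzRingType :=
  match n with
  | m.+2 => 'Z_m.+2
  | _ => Z1
  end.

(* [{poly R}] requires a nontrivial ring [R]. A polynomial over the zero ring
   is zero, so that (Z/1Z)[x] is again the zero ring. The value at [n = 0],
   here and in [Zn], is a dummy. *)
Definition Zpoly (n : nat) : comPzRingType :=
  match n with
  | m.+2 => {poly 'Z_m.+2}
  | _ => Z1
  end.

Definition Zeval (n : nat) : Zpoly n -> Zn n -> Zn n :=
  match n with
  | m.+2 => fun (F : {poly 'Z_m.+2}) (a : 'Z_m.+2) => F.[a]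
  | _ => fun _ _ => 0
  end.

Definition reduce (n : nat) : {poly int} -> Zpoly n :=
  match n with
  | m.+2 => fun P => map_poly (fun z : int => z%:~R : 'Z_m.+2) P
  | _ => fun _ => 0
  end.

Definition vanishing (n : nat) (F : Zpoly n) : Prop :=
  forall a : Zn n, Zeval F a = 0.

Definition ideal_generated (A : comPzRingType) (S : A -> Prop) (F : A) : Prop :=
  exists (m : nat) (q g : 'I_m -> A),
    (forall i, S (g i)) /\ F = \sum_(i < m) q i * g i.

Definition generates (A : comPzRingType) (S I : A -> Prop) : Prop :=
  forall F : A, I F <-> ideal_generated S F.

Definition linear_product (k : nat) (c : 'I_k -> int) : {poly int} :=
  \prod_(j < k) ('X + (c j)%:P).

Definition B (k : nat) : {poly int} := \prod_(j < k) ('X + (j.+1%:Z)%:P).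

Definition admissible (n k : nat) (P : {poly int}) : Prop :=
  forall x : int, ((gcdn n k`!)%:Z %| P.[x])%Z.

Definition replacement (n k : nat) (P : {poly int}) : Prop :=
  exists c : 'I_k -> int, P = linear_product c /\ admissible n k P.

Definition generators (n : nat) (P : nat -> {poly int}) (F : Zpoly n) : Prop :=
  exists k : nat, F = reduce n ((n %/ gcdn k`! n)%N%:Z *: P k).

(* (x + i)(x + i + 1)...(x + i + k - 1) *)
Definition shifted_product (i : int) (k : nat) : {poly int} :=
  linear_product (fun j : 'I_k => i + (j : nat)%:Z).

(* Main.v *)
(** A monic polynomial of degree [k] whose values are divisible by [gcd(n, k!)]
    gives a vanishing polynomial after multiplication by [n / gcd(k!, n)].
    Conversely, the [d]-th finite difference of a polynomial of degree at most
    [d] is the constant [d!] times its coefficient of degree [d]; so for a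
    vanishing polynomial over Z/nZ this coefficient is a multiple of
    [n / gcd(d!, n)], and the term of degree [d] is removed by subtracting a
    multiple of the [d]-th generator.  Only the degree, the leading coefficient
    and the divisibility of the values matter, which is why the linear factors
    are arbitrary. *)

Require Import Defs.
From mathcomp Require Import all_boot all_order all_algebra.
From mathcomp Require Import ring.

Set Implicit Arguments.
Unset Strict Implicit.
Unset Printing Implicit Defensive.

Import GRing.Theory.

Local Open Scope ring_scope.

Lemma ideal_generated0 (A : comPzRingType) (S : A -> Prop) :
  ideal_generated S 0.
Proof.
exists 0%N, (fun=> 0), (fun=> 0); split; first by case.
by rewrite big_ord0.
Qed.

Lemma ideal_generatedMD (A : comPzRingType) (S : A -> Prop) (c g F : A) :
  S g -> ideal_generated S F -> ideal_generated S (c * g + F).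
Proof.
move=> Sg [m [q [h [Sh ->]]]].
(* [unlift ord0] is [None] exactly at index 0, which holds the new pair; the old pairs move up by
   one. *)
exists m.+1, (fun i => oapp q c (unlift ord0 i)),
  (fun i => oapp h g (unlift ord0 i)); split.
  by move=> i; case: unliftP => [j|] _ /=.
rewrite big_ord_recl unlift_none /=; congr (_ + _).
by apply: eq_bigr => i _; rewrite liftK.
Qed.

(** By the binomial theorem, degree [j] of the shifted polynomial receives ['C(i, j)] times the
    [i]-th coefficient. In degrees [d] and above, only [i = d] and [i = d.+1] can contribute. *)
Lemma coef_shift_diff (R : nzRingType) (d : nat) (p : {poly R}) (j : nat) :
    (size p <= d.+2)%N -> (d <= j)%N ->
  ((p \Po ('X + 1)) - p)`_j = if j == d then p`_d.+1 *+ d.+1 else 0.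
Proof.
move=> sp dj.
have coefX1 i : (('X + 1 : {poly R}) ^+ i)`_j = 'C(i, j)%:R.
  rewrite exprD1n coef_sum.
  under eq_bigr => k _ do rewrite coefMn coefXn.
  have [ij|ji] := ltnP i j.
    rewrite bin_small // big1 // => k _.
    by rewrite gtn_eqF ?mul0rn // (leq_trans (ltn_ord k)).
  have ji1 : (j < i.+1)%N by [].
  rewrite (bigD1 (Ordinal ji1)) //= eqxx big1 ?addr0 // => k.
  by rewrite -val_eqE eq_sym => /negbTE /= ->; rewrite mul0rn.
have -> : p \Po ('X + 1) = \sum_(i < d.+2) p`_i *: ('X + 1) ^+ i.
  rewrite comp_polyE (big_ord_widen _ (fun i => p`_i *: ('X + 1) ^+ i) sp).
  rewrite big_mkcond /=; apply: eq_bigr => i _.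
  by case: ltnP => // pi; rewrite nth_default // scale0r.
rewrite coefB coef_sum.
under eq_bigr => i _ do rewrite coefZ coefX1.
rewrite !big_ord_recr /= big1 ?add0r => [|i _]; last first.
  by rewrite bin_small ?mulr0 // (leq_trans (ltn_ord i)).
(* At [j = d] the factor ['C(d.+1, d)] survives; at [j = d.+1] the leading terms cancel; beyond that
   all terms are zero. *)
have [->|jd] := eqVneq j d.
  by rewrite binn binSn mulr1 addrAC subrr add0r mulr_natr.
have dj1 : (d < j)%N by rewrite ltn_neqAle eq_sym jd.
rewrite bin_small // mulr0 add0r.
have [->|jd1] := eqVneq j d.+1; first by rewrite binn mulr1 subrr.
have dj2 : (d.+1 < j)%N by rewrite ltn_neqAle eq_sym jd1.
by rewrite bin_small // mulr0 nth_default ?subr0 // (leq_trans sp).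
Qed.

(** The difference [p(X + 1) - p] again vanishes at all naturals, and its coefficient of degree [d]
    is [d.+1] times that of [p] in degree [d.+1]. Iterating down to a constant collects the
    factorial. *)
Lemma coef_fact_vanishing (R : comNzRingType) (d : nat) (p : {poly R}) :
    (size p <= d.+1)%N -> (forall m : nat, p.[m%:R] = 0) ->
  p`_d *+ d`! = 0.
Proof.
elim: d p => [|d IHd] p sp p0.
  by have := p0 0%N; rewrite (size1_polyC sp) hornerC coefC.
have dE := coef_shift_diff sp.
rewrite factS mulrnA -(_ : ((p \Po ('X + 1)) - p)`_d = p`_d.+1 *+ d.+1).
  apply: IHd => [|m].
    by apply/leq_sizeP => j dj; rewrite dE ?gtn_eqF // ltnW.
  by rewrite hornerD hornerN horner_comp !hornerE natr1 !p0 subrr.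
by rewrite dE // eqxx.
Qed.

Lemma linear_product_monic (k : nat) (c : 'I_k -> int) :
  linear_product c \is monic.
Proof.
rewrite /linear_product.
under eq_bigr => j _ do rewrite -[c j]opprK polyCN.
exact: monic_prod_XsubC.
Qed.

Lemma size_linear_product (k : nat) (c : 'I_k -> int) :
  size (linear_product c) = k.+1.
Proof.
rewrite /linear_product.
under eq_bigr => j _ do rewrite -[c j]opprK polyCN.
by rewrite size_prod_XsubC /index_enum -enumT size_enum_ord.
Qed.

Lemma horner_shifted_product (i : int) (k : nat) (x : int) :
  (shifted_product i k).[x] = \prod_(j < k) (x + i + j%:Z).
Proof.
rewrite horner_prod; apply: eq_bigr => j _.
by rewrite hornerD hornerX hornerC addrA.
Qed.

(** Consecutive values of the product differ by a multiple of [k.+1]!, by induction on [k].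
    Divisibility thus spreads in both directions from [x = 0], where the product is zero. *)
Lemma dvdz_fact_prod (k : nat) (x : int) :
  (k`!%:Z %| \prod_(j < k) (x + j%:Z))%Z.
Proof.
elim: k x => [|k IHk] x; first exact: dvd1z.
pose f (y : int) := \prod_(j < k.+1) (y + j%:Z).
(* The two products share the factors [y + 1] to [y + k]; the remaining factors [y + k + 1] and [y]
   differ by [k.+1]. *)
have df (y : int) : f (y + 1) - f y = k.+1%:Z * \prod_(j < k) (y + 1 + j%:Z).
  rewrite /f big_ord_recr big_ord_recl /= addr0.
  under [X in _ - _ * X]eq_bigr => j _ do
    rewrite /bump /= add1n -addn1 PoszD [_ + 1%:Z]addrC addrA.
  by rewrite -addn1 PoszD; ring.
have dfk (y : int) : (k.+1`!%:Z %| f (y + 1))%Z = (k.+1`!%:Z %| f y)%Z.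
  rewrite -[f (y + 1)](subrK (f y)) rpredDl // df factS PoszM.
  exact: dvdz_mul.
rewrite -/(f x); elim/int_rect: x => [|n|n].
- by rewrite /f big_ord_recl mul0r dvdz0.
- by rewrite intS addrC dfk.
- by move=> fn; rewrite -dfk intS opprD addrAC addNr add0r.
Qed.

Lemma shifted_product_admissible (n : nat) (i : int) (k : nat) :
  admissible n k (shifted_product i k).
Proof.
move=> x; rewrite horner_shifted_product.
apply: dvdz_trans (dvdz_fact_prod k (x + i)).
exact: dvdn_gcdr.
Qed.

Lemma B_shifted_product (k : nat) : B k = shifted_product 1 k.
Proof. by apply: eq_bigr => j _; rewrite -add1n PoszD. Qed.

Lemma shifted_product_replacement (n : nat) (i : int) (k : nat) :
  replacement n k (shifted_product i k).
Proof.
by exists (fun j => i + j%:Z); split; last exact: shifted_product_admissible.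
Qed.

(** With [g] the gcd of [d] and [n], [n] divides [a * d], so [n / g] divides [a * (d / g)]; it is
    coprime to [d / g], hence divides [a]. *)
Lemma Zp_annihilated_by (m d : nat) (a : 'Z_m.+2) :
  a *+ d = 0 -> exists c : 'Z_m.+2, a = c * (m.+2 %/ gcdn d m.+2)%:R.
Proof.
set n := m.+2; set g := gcdn d n => ad0.
have g0 : (0 < g)%N by rewrite gcdn_gt0 orbT.
have na : (n %| a * d)%N.
  rewrite -[a]natr_Zp -mulrnA in ad0.
  by move/(congr1 (@nat_of_ord _)): ad0; rewrite (@val_Zp_nat n) // => /eqP.
have nga : (n %/ g %| a)%N.
  rewrite -(@Gauss_dvdl _ _ (d %/ g)).
    rewrite -(@dvdn_pmul2r g) // -mulnA !divnK ?dvdn_gcdl ?dvdn_gcdr //.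
  rewrite /coprime -(eqn_pmul2r g0) mul1n muln_gcdl.
  by rewrite !divnK ?dvdn_gcdl ?dvdn_gcdr // gcdnC.
exists (a %/ (n %/ g))%:R.
by rewrite -natrM divnK // natr_Zp.
Qed.

Lemma horner_reduce (m : nat) (P : {poly int}) (x : int) :
  (reduce m.+2 P : {poly 'Z_m.+2}).[x%:~R] = P.[x]%:~R.
Proof. exact: horner_map. Qed.

Lemma generator_vanishing (m k : nat) (P : {poly int}) :
    admissible m.+2 k P ->
  vanishing (reduce m.+2 ((m.+2 %/ gcdn k`! m.+2)%N%:Z *: P)).
Proof.
move=> admP a; rewrite /Zeval -[a]natr_Zp -[_%:R]/((a : nat)%:Z%:~R).
rewrite horner_reduce hornerZ.
have /dvdzP[q ->] := admP (a : nat)%:Z.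
rewrite mulrCA gcdnC -PoszM divnK ?dvdn_gcdl // rmorphM /=.
by rewrite [_%:~R in X in _ * X]pchar_Zp // mulr0.
Qed.

Lemma vanishing_generated (m : nat) (P : nat -> {poly int}) :
    (forall k, P k \is monic) -> (forall k, size (P k) = k.+1) ->
    (forall k, admissible m.+2 k (P k)) ->
  forall F : Zpoly m.+2, vanishing F -> ideal_generated (@generators m.+2 P) F.
Proof.
move=> monP szP admP F.
have [d] := ubnPleq (size (F : {poly 'Z_m.+2})).
elim: d F => [|d IHd] F.
  rewrite leqn0 size_poly_eq0 => /eqP -> _; exact: ideal_generated0.
move=> szF vF.
have [c Fd] : exists c, (F : {poly 'Z_m.+2})`_d
    = c * (m.+2 %/ gcdn d`! m.+2)%:R.
  apply: Zp_annihilated_by; apply: coef_fact_vanishing => // j.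
  exact: vF.
pose g : {poly 'Z_m.+2} := reduce m.+2 ((m.+2 %/ gcdn d`! m.+2)%N%:Z *: P d).
have gE j : g`_j = (m.+2 %/ gcdn d`! m.+2)%:R * ((P d)`_j)%:~R.
  by rewrite coef_map coefZ /= intrM.
(* As [P d] is monic of degree [d], the product [c%:P * g] has the same coefficient of degree [d] as
   [F], so the remainder has size at most [d]. *)
have -> : F = (c%:P : {poly _}) * g + ((F : {poly _}) - c%:P * g).
  by rewrite addrC subrK.
apply: ideal_generatedMD; first by exists d.
apply: IHd => [|a].
  apply/leq_sizeP => j; rewrite coefB coefCM gE.
  rewrite leq_eqVlt => /orP[/eqP <-|dj].
    have := monicP (monP d); rewrite /lead_coef szP /= => ->.
    by rewrite mulr1 Fd subrr.
  by rewrite !nth_default ?szP ?mulr0 ?subrr // (leq_trans szF).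
rewrite /Zeval hornerD hornerN hornerM.
rewrite [F.[a]]vF [g.[a]](generator_vanishing (admP d) a).
by rewrite mulr0 subrr.
Qed.

Lemma generates_vanishing (n : nat) (P : nat -> {poly int}) :
    (0 < n)%N -> (forall k, replacement n k (P k)) ->
  generates (@generators n P) (@vanishing n).
Proof.
case: n => [|[|m]] // _ repP F.
  (* For [n = 1] the polynomial ring has a single element, so [F] is zero. *)
  split=> // _; rewrite [F](ord1 _); exact: ideal_generated0.
have admP k : admissible m.+2 k (P k) by case: (repP k) => c [].
split.
  apply: vanishing_generated => // k; case: (repP k) => c [-> _].
    exact: linear_product_monic.
  exact: size_linear_product.
case=> l [q [g [Sg ->]]] a; rewrite /Zeval horner_sum big1 // => i _.
rewrite hornerM; have [k ->] := Sg i.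
by rewrite [X in _ * X](generator_vanishing (admP k) a) mulr0.
Qed.

Theorem mainTheorem4 (n : nat) (n_gt0 : (0 < n)%N) :
  [/\ generates (@generators n B) (@vanishing n),
      forall P : nat -> {poly int},
        (forall k : nat, P k = B k \/ replacement n k (P k)) ->
        generates (@generators n P) (@vanishing n)
    & forall i : nat -> int,
        (forall k : nat, admissible n k (shifted_product (i k) k)) /\
        generates (@generators n (fun k => shifted_product (i k) k))
                  (@vanishing n)].
Proof.
(* Each [B k] is itself a replacement, so unreplaced and replaced indices are treated alike. *)
have repB k : replacement n k (B k).
  rewrite B_shifted_product; exact: shifted_product_replacement.
split=> [|P PB|i].
- exact: generates_vanishing.
- by apply: generates_vanishing => // k; case: (PB k) => [->|].
- split=> [k|]; first exact: shifted_product_admissible.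
  apply: generates_vanishing => // k; exact: shifted_product_replacement.
Qed.
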